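(* Let $C(x)=(x\wedge x')\vee(x\wedge x')^*$. If $L$ is a subdirectly irreducible pseudocomplemented Kleene algebra, then: (1) $L$ satisfies $C(x)'\le C(x)$ for all $x\in L$ if and only if $|Body(L)|=0$. (2) $L$ satisfies $C(x)'\wedge C(x)\le C(y)$ for all $x,y\in L$ if and only if $|Body(L)|\le 1$.
   Context: A pseudocomplemented De Morgan algebra ($pm$-algebra) is an algebra $\langle L,\wedge,\vee,{}',{}^*,0,1\rangle$ such that $\langle L,\wedge,\vee,0,1\rangle$ is a bounded distributive lattice, ${}'$ is a De Morgan negation ($x''=x$, $(x\wedge y)'=x'\vee y'$), and ${}^*$ is a pseudocomplement ($a\wedge b=0\Leftrightarrow b\le a^*$). A pseudocomplemented Kleene algebra ($pk$-algebra) is a $pm$-algebra satisfying $x\wedge x'\le y\vee y'$. Subdirect irreducibility is with respect to the full signature. $\mathbb{X}(L)$ denotes the set of prime filters of $L$ ordered by inclusion; $Max$ and $Min$ denote the sets of its maximal and minimal elements, and $Body(L)=\mathbb{X}(L)\setminus(Max\cup Min)$. *)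

(* Defs.v *)
From HB Require Import structures.
From mathcomp Require Import all_boot all_order.
From mathcomp Require Import boolp classical_sets functions cardinality.

Set Implicit Arguments.
Unset Strict Implicit.
Unset Printing Implicit Defensive.

Import Order.TTheory.

Local Open Scope order_scope.

(* [tbDistrLatticeType] does not require \bot != \top, so the one-element
   algebra is a pm-algebra (and a pk-algebra), as in any variety. *)
HB.mixin Record isPmAlgebra (d : Order.disp_t) L
    of Order.TBDistrLattice d L := {
  dmneg : L -> L;
  pstar : L -> L;
  dmnegK : forall x : L, dmneg (dmneg x) = x;
  dmnegI : forall x y : L, dmneg (x `&` y) = dmneg x `|` dmneg y;
  pstarP : forall a b : L, a `&` b = \bot <-> b <= pstar a
}.

#[short(type="pmAlgType")]
HB.structure Definition PmAlgebra (d : Order.disp_t) :=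
  { L of Order.TBDistrLattice d L & isPmAlgebra d L }.

HB.mixin Record PmAlgebra_isPkAlgebra (d : Order.disp_t) L
    of PmAlgebra d L := {
  kleene : forall x y : L, x `&` dmneg x <= y `|` dmneg y
}.

#[short(type="pkAlgType")]
HB.structure Definition PkAlgebra (d : Order.disp_t) :=
  { L of PmAlgebra d L & PmAlgebra_isPkAlgebra d L }.

Record pm_morphism (d d' : Order.disp_t) (L : pmAlgType d) (M : pmAlgType d')
    (f : L -> M) : Prop := PmMorphism {
  pm_morph0 : f \bot = \bot;
  pm_morph1 : f \top = \top;
  pm_morphI : forall x y : L, f (x `&` y) = f x `&` f y;
  pm_morphU : forall x y : L, f (x `|` y) = f x `|` f y;
  pm_morphN : forall x : L, f (dmneg x) = dmneg (f x);
  pm_morphS : forall x : L, f (pstar x) = pstar (f x)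
}.

(* An embedding x |-> (f i x)_i of L in the direct product of the A i whose
   compositions f i with the projections are onto. The operations of the
   product are componentwise, so the embedding is a homomorphism exactly when
   every f i is one. *)
Record subdirect_embedding (d : Order.disp_t) (L : pmAlgType d) (I : Type)
    (dA : I -> Order.disp_t) (A : forall i, pmAlgType (dA i))
    (f : forall i, L -> A i) : Prop := SubdirectEmbedding {
  subdirect_morph : forall i, pm_morphism (f i);
  subdirect_inj : forall x y : L, (forall i, f i x = f i y) -> x = y;
  subdirect_surj : forall i (a : A i), exists x : L, f i x = a
}.

(* Products are over nonempty index sets, so the one-element algebra counts
   as subdirectly irreducible. *)
Definition subdirectly_irreducible (d : Order.disp_t) (L : pmAlgType d) : Prop :=
  forall (I : Type) (dA : I -> Order.disp_t) (A : forall i, pmAlgType (dA i))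
    (f : forall i, L -> A i),
    inhabited I -> subdirect_embedding f -> exists i, bijective (f i).

Section PrimeFilters.
Variables (d : Order.disp_t) (L : tbDistrLatticeType d).

Record prime_filter (F : set L) : Prop := PrimeFilter {
  prime_filterT : F \top;
  prime_filterI : forall x y : L, F x -> F y -> F (x `&` y);
  prime_filterS : forall x y : L, x <= y -> F x -> F y;
  prime_filter_proper : ~ F \bot;
  prime_filterU : forall x y : L, F (x `|` y) -> F x \/ F y
}.

Definition prime_spec : set (set L) := [set F | prime_filter F]%classic.

Definition spec_max : set (set L) :=
  [set F | prime_spec F /\
     forall G, prime_spec G -> F `<=` G -> G = F]%classic.

Definition spec_min : set (set L) :=
  [set F | prime_spec F /\
     forall G, prime_spec G -> G `<=` F -> G = F]%classic.

End PrimeFilters.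

Arguments prime_spec {d} L _.
Arguments spec_max {d} L _.
Arguments spec_min {d} L _.

Definition Body (d : Order.disp_t) (L : tbDistrLatticeType d) : set (set L) :=
  (prime_spec L `\` (spec_max L `|` spec_min L))%classic.

Arguments Body {d} L _.

Definition Cterm (d : Order.disp_t) (L : pmAlgType d) (x : L) : L :=
  (x `&` dmneg x) `|` pstar (x `&` dmneg x).

(* Main.v *)
Require Import Defs.
From HB Require Import structures.
From mathcomp Require Import all_boot all_order.
From mathcomp Require Import boolp classical_sets functions cardinality.
From mathcomp Require Import generic_quotient.

Set Implicit Arguments.
Unset Strict Implicit.
Unset Printing Implicit Defensive.

Import Order.TTheory.

Local Open Scope classical_set_scope.
Local Open Scope order_scope.

(** The De Morgan negation acts on prime filters by the order-reversing
    involution sending [P] to [dual_filter P], the set of [x] such that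
    [dmneg x] is not in [P]; it exchanges maximal and minimal prime filters, and
    the Kleene inequality makes [P] and [dual_filter P] comparable. Since [L] is
    distributive, an inequality holds iff every prime filter respects it
    ([le_prime_filters]), so both identities can be tested one prime filter at a
    time.

    A maximal prime filter contains every [a `|` pstar a], in particular every
    [Cterm x]; dually a minimal one contains no [dmneg (Cterm x)]. So the
    identities can fail only at the body. If [F] is in the body and below its
    dual, then some [Cterm y] is missing from [dual_filter F]
    ([Body_dmneg_Cterm]), which refutes the first identity. The second identity
    tolerates such a filter only if [dual_filter F = F], and it does hold at a
    self-dual filter, where [Cterm x] and its negation exclude each other. In
    particular it holds when the body has at most one element, as the body is
    closed under [dual_filter].

    Conversely the second identity makes all body filters self-dual, and there
    subdirect irreducibility enters. If two body filters are separated by [a],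
    let one congruence identify elements agreeing on all maximal, all minimal,
    and those body filters that contain [a], and let the other use the body
    filters that avoid [a]. The two congruences meet in the diagonal. Neither is
    trivial ([self_dual_cong_proper]): the maximal prime filters are cut out by
    the conditions [a `|` pstar a], so a body filter can be told apart from
    all maximal and minimal ones by a single dense element. *)

(** * Prime filters of bounded distributive lattices *)

Section PrimeFilterTheorem.
Variables (d : Order.disp_t) (L : tbDistrLatticeType d).
Implicit Types (F P : set L) (x y a : L).

Record lattice_filter F : Prop := LatticeFilter {
  lattice_filterT : F \top;
  lattice_filterI : forall x y, F x -> F y -> F (x `&` y);
  lattice_filterS : forall x y, x <= y -> F x -> F y
}.

Lemma prime_filter_filter P : prime_filter P -> lattice_filter P.
Proof. by case. Qed.

Definition filter_adjoin F a : set L :=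
  [set y | exists2 z, F z & z `&` a <= y].

Lemma filter_adjoin_filter F a :
  lattice_filter F -> lattice_filter (filter_adjoin F a).
Proof.
case=> FT FI FS; split.
- by exists \top => //; exact: lex1.
- move=> x y [z Fz zx] [t Ft ty]; exists (z `&` t); first exact: FI.
  rewrite lexI (le_trans _ zx) ?(le_trans _ ty) //.
    by rewrite leI2 // leIr.
  by rewrite leI2 // leIl.
- by move=> x y xy [z Fz zx]; exists z => //; exact: le_trans xy.
Qed.

Lemma filter_adjoin_sub F a : F `<=` filter_adjoin F a.
Proof. by move=> x Fx; exists x => //; exact: leIl. Qed.

Lemma filter_adjoin_mem F a : lattice_filter F -> filter_adjoin F a a.
Proof. by case=> FT _ _; exists \top => //; exact: leIr. Qed.

(** A filter maximal among those containing [F] and avoiding [a] is prime: if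
    it contained [x `|` y] but neither [x] nor [y], adjoining either of these
    would capture [a], and distributivity would already put [a] in it. *)
Lemma prime_filter_separation F a : lattice_filter F -> ~ F a ->
  exists P, [/\ prime_filter P, F `<=` P & ~ P a].
Proof.
move=> Ff Fa.
(* Zorn's lemma also asks about the empty chain, whose union is empty; hence
   containing [F] and [\top] is required of inhabited sets only. *)
pose S (X : set L) := [/\ (forall x, X x -> F `<=` X),
   (forall x y, X x -> X y -> X (x `&` y)),
   (forall x y, x <= y -> X x -> X y) & ~ X a].
have [C CS Ctot|P [PS Pmax]] := @Zorn_bigcup _ S.
  split.
  - move=> x [X CX Xx] y Fy; exists X => //.
    by case: (CS _ CX) => + _ _ _; apply; eassumption.
  - move=> x y [X CX Xx] [Y CY Yy].
    case: (Ctot _ _ CX CY) => sub.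
    + by exists Y => //; case: (CS _ CY) => _ + _ _; apply => //; exact: sub.
    + by exists X => //; case: (CS _ CX) => _ + _ _; apply => //; exact: sub.
  - move=> x y xy [X CX Xx]; exists X => //.
    by case: (CS _ CX) => _ _ + _; apply; eassumption.
  - by move=> [X CX Xa]; case: (CS _ CX).
have SF X : lattice_filter X -> F `<=` X -> ~ X a -> S X.
  by case=> ? ? ? ? ?; split.
have [x0 Px0] : exists x, P x.
  apply: contrapT => P0; apply: (Pmax F); last exact: SF.
  split; first by move=> x Px; case: P0; exists x.
  by move=> /(_ _ (lattice_filterT Ff)) PT; apply: P0; exists \top.
case: PS => /(_ _ Px0) FP PI PU Pa.
have Pf : lattice_filter P by split => //; exact/FP/(lattice_filterT Ff).
have Padj x : ~ P x -> filter_adjoin P x a.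
  move=> Px; apply: contrapT => Pxa; apply: (Pmax (filter_adjoin P x)).
    split; first exact: filter_adjoin_sub.
    by move=> /(_ _ (filter_adjoin_mem x Pf)).
  apply: SF => //; first exact: filter_adjoin_filter.
  exact: subset_trans FP (@filter_adjoin_sub P x).
exists P; split => //; split => //.
- exact: lattice_filterT.
- by move=> P0; apply: Pa; apply: PU P0; exact: le0x.
- move=> x y Pxy; apply: contrapT => /not_orP[/Padj[z Pz zx] /Padj[t Pt ty]].
  apply: Pa; apply: (PU ((x `|` y) `&` (z `&` t))); last exact/PI/PI.
  rewrite meetUl leUx (le_trans _ zx) ?(le_trans _ ty) //.
    by rewrite meetC leI2 // leIr.
  by rewrite meetC leI2 // leIl.
Qed.

Lemma le_prime_filters x y :
  (forall P, prime_filter P -> P x -> P y) -> x <= y.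
Proof.
move=> xy; apply: contrapT => nxy.
have xf : lattice_filter [set z | x <= z]%classic.
  split=> /=; first exact: lex1.
    by move=> u v xu xv; rewrite lexI xu.
  by move=> u v uv xu; exact: le_trans uv.
have [P [Pp xP Py]] := prime_filter_separation xf nxy.
by apply: Py; apply: xy => //; apply: xP; exact: lexx.
Qed.

End PrimeFilterTheorem.

(** * Arithmetic of the two negations *)

Section PmArithmetic.
Variables (d : Order.disp_t) (L : pmAlgType d).
Implicit Types (x y z : L).

Lemma dmnegU x y : dmneg (x `|` y) = dmneg x `&` dmneg y.
Proof. by rewrite -{1}[x]dmnegK -{1}[y]dmnegK -dmnegI dmnegK. Qed.

Lemma dmneg_anti x y : x <= y -> dmneg y <= dmneg x.
Proof. by move=> /meet_idPl <-; rewrite dmnegI leUr. Qed.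

Lemma dmneg1 : dmneg (\top : L) = \bot.
Proof. by apply/eqP; rewrite -lex0 -[\bot]dmnegK dmneg_anti // lex1. Qed.

Lemma dmneg0 : dmneg (\bot : L) = \top.
Proof. by rewrite -dmneg1 dmnegK. Qed.

Lemma meet_pstar x : x `&` pstar x = \bot.
Proof. exact/pstarP. Qed.

Lemma le_pstarI x y z : (z <= pstar (x `&` y)) = (y `&` z <= pstar x).
Proof. by apply/idP/idP => /pstarP xyz; apply/pstarP; rewrite -xyz meetA. Qed.

Lemma le_pstarU x y z :
  (z <= pstar (x `|` y)) = (z <= pstar x) && (z <= pstar y).
Proof.
apply/idP/andP => [/pstarP xyz|[/pstarP xz /pstarP yz]].
  by split; apply/pstarP/eqP; rewrite -lex0 -xyz leI2 // ?leUl ?leUr.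
by apply/pstarP; rewrite meetUl xz yz joinxx.
Qed.

Lemma pstarU x y : pstar (x `|` y) = pstar x `&` pstar y.
Proof. by apply: le_anti; rewrite lexI -le_pstarU lexx le_pstarU -lexI lexx. Qed.

Lemma pstar_anti x y : x <= y -> pstar y <= pstar x.
Proof. by move=> /join_idPl <-; rewrite pstarU leIr. Qed.

Lemma eq_pstarI x1 x2 y1 y2 : pstar x1 = pstar x2 -> pstar y1 = pstar y2 ->
  pstar (x1 `&` y1) = pstar (x2 `&` y2).
Proof.
have leL (a b c : L) : pstar a = pstar b -> pstar (a `&` c) <= pstar (b `&` c).
  by move=> ab; rewrite le_pstarI -ab -le_pstarI.
have eqL (a b c : L) : pstar a = pstar b -> pstar (a `&` c) = pstar (b `&` c).
  by move=> ab; apply: le_anti; rewrite !leL.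
by move=> x12 y12; rewrite (eqL _ _ _ x12) ![x2 `&` _]meetC (eqL _ _ _ y12).
Qed.

Lemma pstar_dense x : pstar (x `|` pstar x) = \bot.
Proof. by rewrite pstarU meet_pstar. Qed.

Lemma pstar_meet_dense x y : pstar y = \bot -> pstar (x `&` y) = pstar x.
Proof.
move=> y0; apply: le_anti; apply/andP; split; last exact/pstar_anti/leIl.
by apply/pstarP/eqP; rewrite -lex0 -y0 -le_pstarI meetC.
Qed.

End PmArithmetic.

(** * Congruences and subdirect irreducibility *)

Record pm_congruence (d : Order.disp_t) (L : pmAlgType d) := PmCongruence {
  cong_rel :> L -> L -> Prop;
  cong_refl : forall x, cong_rel x x;
  cong_sym : forall x y, cong_rel x y -> cong_rel y x;
  cong_trans : forall y x z, cong_rel x y -> cong_rel y z -> cong_rel x z;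
  congI : forall x1 x2 y1 y2, cong_rel x1 x2 -> cong_rel y1 y2 ->
    cong_rel (x1 `&` y1) (x2 `&` y2);
  congN : forall x y, cong_rel x y -> cong_rel (dmneg x) (dmneg y);
  congS : forall x y, cong_rel x y -> cong_rel (pstar x) (pstar y)
}.

Section Quotient.
Variables (d : Order.disp_t) (L : pmAlgType d) (E : pm_congruence L).
Implicit Types (x y : L).

Lemma congU x1 x2 y1 y2 : E x1 x2 -> E y1 y2 -> E (x1 `|` y1) (x2 `|` y2).
Proof.
move=> x12 y12; rewrite -[x1 `|` y1]dmnegK -[x2 `|` y2]dmnegK !dmnegU.
by apply/congN/congI; exact: congN.
Qed.

Definition cong_bool : rel L := fun x y => `[< E x y >].

Lemma cong_bool_refl : reflexive cong_bool.
Proof. by move=> x; apply/asboolP; exact: cong_refl. Qed.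

Lemma cong_bool_sym : symmetric cong_bool.
Proof. by move=> x y; apply: asbool_equiv_eq; split; exact: cong_sym. Qed.

Lemma cong_bool_trans : transitive cong_bool.
Proof.
by move=> y x z /asboolP xy /asboolP yz; apply/asboolP; exact: cong_trans yz.
Qed.

Canonical cong_equiv :=
  EquivRel cong_bool cong_bool_refl cong_bool_sym cong_bool_trans.

Definition pm_quot := {eq_quot cong_equiv}%qT.
HB.instance Definition _ := Choice.on pm_quot.

Definition pm_class (x : L) : pm_quot := \pi_({eq_quot cong_equiv})%qT x.
Definition pm_repr (q : pm_quot) : L := repr (q : {eq_quot cong_equiv}%qT).

Lemma pm_reprK : cancel pm_repr pm_class.
Proof. by move=> q; exact: reprK. Qed.

Lemma pm_classP x y : pm_class x = pm_class y <-> E x y.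
Proof.
split=> [/eqquotP/asboolP //|xy].
by apply/eqquotP/asboolP.
Qed.

Lemma pm_repr_class x : E (pm_repr (pm_class x)) x.
Proof. by apply/pm_classP; rewrite pm_reprK. Qed.

Definition quot_meet (p q : pm_quot) := pm_class (pm_repr p `&` pm_repr q).
Definition quot_join (p q : pm_quot) := pm_class (pm_repr p `|` pm_repr q).
Definition quot_neg (p : pm_quot) := pm_class (dmneg (pm_repr p)).
Definition quot_star (p : pm_quot) := pm_class (pstar (pm_repr p)).

Lemma quot_meetE x y : quot_meet (pm_class x) (pm_class y) = pm_class (x `&` y).
Proof. by apply/pm_classP/congI; exact: pm_repr_class. Qed.

Lemma quot_joinE x y : quot_join (pm_class x) (pm_class y) = pm_class (x `|` y).
Proof. by apply/pm_classP/congU; exact: pm_repr_class. Qed.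

Lemma quot_negE x : quot_neg (pm_class x) = pm_class (dmneg x).
Proof. by apply/pm_classP/congN; exact: pm_repr_class. Qed.

Lemma quot_starE x : quot_star (pm_class x) = pm_class (pstar x).
Proof. by apply/pm_classP/congS; exact: pm_repr_class. Qed.

Lemma pm_classW (Q : pm_quot -> Prop) : (forall x, Q (pm_class x)) -> forall q, Q q.
Proof. by move=> Qx q; rewrite -[q]pm_reprK. Qed.

Fact quot_meetC : commutative quot_meet.
Proof.
by elim/pm_classW=> x; elim/pm_classW=> y; rewrite !quot_meetE meetC.
Qed.

Fact quot_joinC : commutative quot_join.
Proof.
by elim/pm_classW=> x; elim/pm_classW=> y; rewrite !quot_joinE joinC.
Qed.

Fact quot_meetA : associative quot_meet.
Proof.
elim/pm_classW=> x; elim/pm_classW=> y; elim/pm_classW=> z.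
by rewrite !quot_meetE meetA.
Qed.

Fact quot_joinA : associative quot_join.
Proof.
elim/pm_classW=> x; elim/pm_classW=> y; elim/pm_classW=> z.
by rewrite !quot_joinE joinA.
Qed.

Fact quot_joinKI q p : quot_meet p (quot_join p q) = p.
Proof.
elim/pm_classW: p => x; elim/pm_classW: q => y.
by rewrite quot_joinE quot_meetE joinKI.
Qed.

Fact quot_meetKU q p : quot_join p (quot_meet p q) = p.
Proof.
elim/pm_classW: p => x; elim/pm_classW: q => y.
by rewrite quot_meetE quot_joinE meetKU.
Qed.

Fact quot_meetUl : left_distributive quot_meet quot_join.
Proof.
elim/pm_classW=> x; elim/pm_classW=> y; elim/pm_classW=> z.
by rewrite quot_joinE !quot_meetE quot_joinE meetUl.
Qed.

Fact quot_meetxx : idempotent_op quot_meet.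
Proof. by elim/pm_classW=> x; rewrite quot_meetE meetxx. Qed.

HB.instance Definition _ := Order.isMeetJoinDistrLattice.Build d pm_quot
  (fun _ _ => erefl) (fun _ _ => erefl) quot_meetC quot_joinC quot_meetA
  quot_joinA quot_joinKI quot_meetKU quot_meetUl quot_meetxx.

Lemma quot_leE (p q : pm_quot) : (p <= q) = (quot_meet p q == p).
Proof. by []. Qed.

Fact quot_le0x (q : pm_quot) : pm_class \bot <= q.
Proof.
by elim/pm_classW: q => x; rewrite quot_leE quot_meetE meet0x.
Qed.

Fact quot_lex1 (q : pm_quot) : q <= pm_class \top.
Proof.
by elim/pm_classW: q => x; rewrite quot_leE quot_meetE meetx1.
Qed.

HB.instance Definition _ := Order.hasBottom.Build d pm_quot quot_le0x.
HB.instance Definition _ := Order.hasTop.Build d pm_quot quot_lex1.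

Fact quot_negK (p : pm_quot) : quot_neg (quot_neg p) = p.
Proof. by elim/pm_classW: p => x; rewrite !quot_negE dmnegK. Qed.

Fact quot_negI (p q : pm_quot) :
  quot_neg (p `&` q) = quot_neg p `|` quot_neg q.
Proof.
elim/pm_classW: p => x; elim/pm_classW: q => y.
by rewrite [_ `&` _]quot_meetE !quot_negE [_ `|` _]quot_joinE dmnegI.
Qed.

(** Pseudocomplementation is characterised by an equivalence rather than by
    identities, so it does not pass to the quotient for free: from
    [x `&` y] congruent to [\bot] one recovers [y <= pstar x] modulo [E]
    through [y `&` pstar (x `&` y) <= pstar x]. *)
Fact quot_starP (p q : pm_quot) : p `&` q = \bot <-> q <= quot_star p.
Proof.
elim/pm_classW: p => x; elim/pm_classW: q => y.
rewrite [_ `&` _]quot_meetE quot_starE quot_leE quot_meetE.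
split=> [/pm_classP xy0|/eqP/pm_classP ysx].
  have /(congI (cong_refl E y)) := congS xy0.
  have -> : pstar (\bot : L) = \top.
    by apply/eqP; rewrite -le1x; apply/pstarP; rewrite meet0x.
  rewrite meetx1 => ty; apply/eqP/pm_classP; apply: cong_trans (ty).
  apply: cong_trans (congI (cong_sym ty) (cong_refl E _)) _.
  have /meet_idPl -> : y `&` pstar (x `&` y) <= pstar x by rewrite -le_pstarI.
  exact: cong_refl.
apply/pm_classP; apply: cong_trans (congI (cong_refl E x) (cong_sym ysx)) _.
by rewrite meetCA meet_pstar meetx0; exact: cong_refl.
Qed.

HB.instance Definition _ :=
  isPmAlgebra.Build d pm_quot quot_negK quot_negI quot_starP.

Lemma pm_class_morphism : pm_morphism (pm_class : L -> pm_quot).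
Proof.
split=> // *; by rewrite -?quot_meetE -?quot_joinE -?quot_negE -?quot_starE.
Qed.

End Quotient.

(** Two congruences meeting in the diagonal embed [L] subdirectly in the
    product of the two quotients. *)
Lemma subdirectly_irreducible_congruences (d : Order.disp_t) (L : pmAlgType d)
    (E0 E1 : pm_congruence L) :
  subdirectly_irreducible L ->
  (forall x y, E0 x y -> E1 x y -> x = y) ->
  (forall x y, E0 x y -> x = y) \/ (forall x y, E1 x y -> x = y).
Proof.
move=> Lsi E01.
pose E (b : bool) := if b then E1 else E0.
pose A (b : bool) : pmAlgType d := pm_quot (E b).
pose f (b : bool) : L -> A b := @pm_class d L (E b).
have fsub : subdirect_embedding f.
  split=> [b|x y fxy|b q]; first exact: pm_class_morphism.
    by apply: E01; [exact/pm_classP/(fxy false)|exact/pm_classP/(fxy true)].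
  by exists (pm_repr q); exact: pm_reprK.
have [b /bij_inj finj] := Lsi _ _ _ _ (inhabits true) fsub.
have {}finj x y : E b x y -> x = y by move=> /pm_classP xy; exact: finj.
by case: b finj; [right|left].
Qed.

(** * The De Morgan dual of a prime filter *)

Section Dual.
Variables (d : Order.disp_t) (L : pmAlgType d).
Implicit Types (P F G : set L) (x y z : L).

Definition dual_filter P : set L := [set x | ~ P (dmneg x)].

Lemma dual_filterK : involutive dual_filter.
Proof.
move=> P; apply/seteqP; split=> x; rewrite /dual_filter /= dmnegK.
  exact: contrapT.
by move=> Px; apply.
Qed.

Lemma dual_filterS P F : P `<=` F -> dual_filter F `<=` dual_filter P.
Proof. by move=> PF x /= nFx /PF. Qed.

Lemma dual_filter_prime P : prime_filter P -> prime_filter (dual_filter P).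
Proof.
case=> PT PI PS P0 PU; split; rewrite /dual_filter /=.
- by rewrite dmneg1.
- by move=> x y nx ny; rewrite dmnegI => /PU[].
- by move=> x y /dmneg_anti yx nx /(PS _ _ yx).
- by rewrite dmneg0; apply.
- by move=> x y; rewrite dmnegU => nxy; apply/not_andP => -[? ?]; apply/nxy/PI.
Qed.

Lemma spec_max_dual P : spec_max L P -> spec_min L (dual_filter P).
Proof.
case=> Pp Pmax; split; first exact: dual_filter_prime.
move=> G Gp /dual_filterS; rewrite dual_filterK => PG.
by rewrite -[G]dual_filterK (Pmax _ _ PG) //; exact: dual_filter_prime.
Qed.

Lemma spec_min_dual P : spec_min L P -> spec_max L (dual_filter P).
Proof.
case=> Pp Pmin; split; first exact: dual_filter_prime.
move=> G Gp /dual_filterS; rewrite dual_filterK => GP.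
by rewrite -[G]dual_filterK (Pmin _ _ GP) //; exact: dual_filter_prime.
Qed.

Lemma Body_dual P : Body L P -> Body L (dual_filter P).
Proof.
case=> Pp nP; split; first exact: dual_filter_prime.
by move=> [/spec_max_dual|/spec_min_dual]; rewrite dual_filterK => ?;
  apply: nP; [right|left].
Qed.

Lemma prime_filter_meet P x y : prime_filter P -> P (x `&` y) <-> P x /\ P y.
Proof.
move=> [_ PI PS _ _]; split=> [Pxy|[]]; last exact: PI.
by split; apply: PS Pxy; [exact: leIl|exact: leIr].
Qed.

Lemma prime_filter_join P x y : prime_filter P -> P (x `|` y) <-> P x \/ P y.
Proof.
move=> [_ _ PS _ PU]; split; first exact: PU.
by case; apply: PS; [exact: leUl|exact: leUr].
Qed.

Lemma prime_filter_pstar P x : prime_filter P -> P x -> ~ P (pstar x).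
Proof.
by move=> Pp Px Psx; apply: (prime_filter_proper Pp); rewrite -(meet_pstar x);
  exact: prime_filterI.
Qed.

(** If a maximal [P] misses [x], then adjoining [x] to it must produce
    [\bot], so some [z] in [P] lies below [pstar x]. *)
Lemma spec_max_dense P x : spec_max L P -> P (x `|` pstar x).
Proof.
move=> [Pp Pmax]; apply/prime_filter_join => //.
apply: contrapT => /not_orP[Px Psx].
have Pf := prime_filter_filter Pp.
have nadj : ~ filter_adjoin P x \bot.
  move=> [z Pz zx]; apply: Psx; apply: (prime_filterS Pp _ Pz).
  by apply/pstarP/eqP; rewrite -lex0 meetC.
have [G [Gp PG _]] := prime_filter_separation (filter_adjoin_filter x Pf) nadj.
apply: Px; rewrite -(Pmax G Gp); first exact/PG/filter_adjoin_mem.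
exact: subset_trans (@filter_adjoin_sub _ _ P x) PG.
Qed.

Lemma nspec_max_dense P : prime_filter P -> ~ spec_max L P ->
  exists x, ~ P (x `|` pstar x).
Proof.
move=> Pp nP; apply: contrapT => dense; apply: nP; split=> // G Gp PG.
apply/seteqP; split=> // x Gx; apply: contrapT => Px; apply: dense.
exists x => /(prime_filter_join _ _ Pp)[//|/PG].
exact: prime_filter_pstar.
Qed.

Lemma spec_max_pstar P x : spec_max L P -> P x <-> ~ P (pstar x).
Proof.
move=> Pm; have [Pp _] := Pm; split; first exact: prime_filter_pstar.
by case/(prime_filter_join _ _ Pp): (spec_max_dense x Pm).
Qed.

(** [dual_filter P] is maximal, and [Cterm x] has the form [a `|` pstar a]. *)
Lemma spec_min_Cterm P x : spec_min L P -> ~ P (dmneg (Cterm x)).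
Proof. by move=> /spec_min_dual/(spec_max_dense (x `&` dmneg x)). Qed.

Lemma prime_spec_cases P : prime_filter P ->
  [\/ spec_max L P, spec_min L P | Body L P].
Proof.
move=> Pp; have [Pm|nPm] := pselect (spec_max L P); first exact: Or31.
have [Pm|nPn] := pselect (spec_min L P); first exact: Or32.
by apply: Or33; split=> // -[].
Qed.

(** Any [y] separating [dual_filter F] from a larger prime filter [G] works:
    [F `<=` G] puts [y `&` dmneg y] in [G], so that its star is missing
    from [G], hence from [dual_filter F]. *)
Lemma Body_dmneg_Cterm F : Body L F -> F `<=` dual_filter F ->
  exists y, F (dmneg (Cterm y)).
Proof.
move=> BF FdF; have [dFp ndF] := Body_dual BF.
have [G [Gp dFG [y Gy ndFy]]] : exists G,
    [/\ prime_filter G, dual_filter F `<=` G & exists2 y, G y & ~ dual_filter F y].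
  apply: contrapT => nG; apply: ndF; left; split=> // G Gp dFG.
  apply/seteqP; split=> // y Gy; apply: contrapT => ny; apply: nG.
  by exists G; split=> //; exists y.
exists y; apply: contrapT; rewrite -/(dual_filter F (Cterm y)).
case/(prime_filter_join _ _ dFp).
  by move=> /(prime_filter_meet _ _ dFp)[].
move=> /dFG; apply: prime_filter_pstar => //; apply: prime_filterI => //.
by apply/dFG/FdF; apply: contrapT.
Qed.

End Dual.

(** The Kleene inequality compares every prime filter with its dual. *)
Lemma dual_filter_comparable (d : Order.disp_t) (L : pkAlgType d) (P : set L) :
  prime_filter P -> P `<=` dual_filter P \/ dual_filter P `<=` P.
Proof.
move=> Pp; apply: contrapT => /not_orP[].
move=> /existsNP[x /not_implyP[Px /contrapT Pnx]].
move=> /existsNP[y /not_implyP[Pny nPy]].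
have : P (y `|` dmneg y).
  by apply: (prime_filterS Pp (kleene x y)); exact: prime_filterI.
by case/(prime_filter_join _ _ Pp).
Qed.

(** * Congruences attached to self-dual prime filters *)

Section SelfDual.
Variables (d : Order.disp_t) (L : pmAlgType d) (Y : set (set L)).
Hypothesis Yprime : forall P, Y P -> prime_filter P.
Hypothesis Ydual : forall P, Y P -> dual_filter P = P.
Implicit Types (x y z : L).

(** The prime filters on which congruent elements must agree are the maximal
    ones (through [pstar x = pstar y]), the minimal ones (through
    [dmneg x] and [dmneg y]) and those in [Y]. Compatibility with [pstar] is
    then automatic, as congruent elements have equal stars. *)
Definition self_dual_rel x y :=
  [/\ pstar x = pstar y, pstar (dmneg x) = pstar (dmneg y) &
      forall P, Y P -> P x <-> P y].

Lemma self_dual_relI x1 x2 y1 y2 : self_dual_rel x1 x2 -> self_dual_rel y1 y2 ->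
  self_dual_rel (x1 `&` y1) (x2 `&` y2).
Proof.
move=> [sx nx Px] [sy ny Py]; split; first exact: eq_pstarI.
  by rewrite !dmnegI !pstarU nx ny.
move=> P YP; have Pp := Yprime YP.
by rewrite !prime_filter_meet // (Px _ YP) (Py _ YP).
Qed.

Lemma self_dual_relN x y :
  self_dual_rel x y -> self_dual_rel (dmneg x) (dmneg y).
Proof.
move=> [sx nx Px]; split=> //; first by rewrite !dmnegK.
by move=> P YP; rewrite -(Ydual YP) /dual_filter /= !dmnegK (Px _ YP).
Qed.

Lemma self_dual_relS x y :
  self_dual_rel x y -> self_dual_rel (pstar x) (pstar y).
Proof. by move=> [-> _ _]; split. Qed.

Lemma self_dual_rel_refl x : self_dual_rel x x.
Proof. by []. Qed.

Lemma self_dual_rel_sym x y : self_dual_rel x y -> self_dual_rel y x.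
Proof. by move=> [sx nx Px]; split=> // P YP; rewrite Px. Qed.

Lemma self_dual_rel_trans y x z :
  self_dual_rel x y -> self_dual_rel y z -> self_dual_rel x z.
Proof.
move=> [sx nx Px] [sy ny Py]; split; [by rewrite sx|by rewrite nx|].
by move=> P YP; rewrite Px // Py.
Qed.

Definition self_dual_cong : pm_congruence L :=
  PmCongruence self_dual_rel_refl self_dual_rel_sym self_dual_rel_trans
    self_dual_relI self_dual_relN self_dual_relS.

(** As [G] is not maximal it misses a dense [w]. The elements [dmneg w] and
    [dmneg w `&` (w `|` a)] agree on maximal filters, where [w] holds, on
    minimal ones, where [dmneg w] fails, and wherever [a] holds; but [G],
    being self-dual, contains [dmneg w] and separates them. *)
Lemma self_dual_cong_proper G a : prime_filter G -> ~ spec_max L G ->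
  dual_filter G = G -> (forall P, Y P -> P a) -> ~ G a ->
  exists x y, self_dual_cong x y /\ x <> y.
Proof.
move=> Gp Gm Gd Ya Ga; have [c] := nspec_max_dense Gp Gm.
move: (c `|` pstar c) (pstar_dense c) => w sw nGw.
have Gnw : G (dmneg w) by rewrite -Gd /dual_filter /= dmnegK.
exists (dmneg w), (dmneg w `&` (w `|` a)); split; last first.
  move=> e; have : G (w `|` a).
    by move: Gnw; rewrite e => /(prime_filter_meet _ _ Gp)[].
  by case/(prime_filter_join _ _ Gp).
split.
- by rewrite pstar_meet_dense // pstarU sw meet0x.
- by rewrite dmnegI dmnegK pstarU sw meet0x.
- move=> P YP; have Pp := Yprime YP; rewrite prime_filter_meet //.
  split=> [Pw|[]//]; split=> //; apply/prime_filter_join => //; right.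
  exact: Ya.
Qed.

End SelfDual.

(** * The two identities and the size of the body *)

(** An [a] lying in just one of two body filters splits the body in two, giving
    two congruences: elements congruent for both agree on every prime filter,
    while each congruence is nontrivial because of the body filter in the
    other half. *)
Lemma self_dual_Body_unique (d : Order.disp_t) (L : pmAlgType d) (F G : set L) :
  subdirectly_irreducible L ->
  (forall P, Body L P -> dual_filter P = P) ->
  Body L F -> Body L G -> F = G.
Proof.
move=> Lsi Bdual BF BG.
suff sub F1 G1 : Body L F1 -> Body L G1 -> F1 `<=` G1.
  by apply/seteqP; split; exact: sub.
move=> {F G BF BG} BF BG a Fa; apply: contrapT => Ga.
have Fna : ~ F1 (dmneg a) by move: Fa; rewrite -{1}(Bdual _ BF).
pose Ya : set (set L) := [set P | Body L P /\ P a].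
pose Yna : set (set L) := [set P | Body L P /\ P (dmneg a)].
have Yap P : Ya P -> prime_filter P by move=> [[]].
have Ynap P : Yna P -> prime_filter P by move=> [[]].
have Yad P : Ya P -> dual_filter P = P by move=> [/Bdual].
have Ynad P : Yna P -> dual_filter P = P by move=> [/Bdual].
have nmax P : Body L P -> ~ spec_max L P by move=> [_ nP] Pm; apply: nP; left.
have le_cong x y : self_dual_cong Yap Yad x y -> self_dual_cong Ynap Ynad x y ->
    x <= y.
  move=> [sxy nxy Yaxy] [_ _ Ynaxy]; apply: le_prime_filters => P Pp.
  have [Pm|Pm|BP] := prime_spec_cases Pp.
  - by rewrite (spec_max_pstar x Pm) (spec_max_pstar y Pm) sxy.
  - have dPm := spec_min_dual Pm.
    rewrite -[P]dual_filterK /= => Px dPy; apply: Px; move: dPy.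
    by rewrite (spec_max_pstar (dmneg x) dPm) (spec_max_pstar (dmneg y) dPm) nxy.
  - have [Pa|nPa] := pselect (P a); first by move=> /Yaxy; apply.
    have Pna : P (dmneg a).
      by apply: contrapT => nPna; apply: nPa; rewrite -(Bdual _ BP).
    by move=> /Ynaxy; apply.
have [|E|E] :=
  @subdirectly_irreducible_congruences _ _ (self_dual_cong Yap Yad)
    (self_dual_cong Ynap Ynad) Lsi.
- move=> x y xy xy'; apply: le_anti.
  by rewrite !le_cong //; exact: cong_sym.
- have [|//|x [y [/E //]]] :=
    @self_dual_cong_proper _ _ _ Yap Yad G1 a (proj1 BG) (nmax _ BG) (Bdual _ BG).
  by move=> P [].
- have [|//|x [y [/E //]]] := @self_dual_cong_proper _ _ _ Ynap Ynad F1 (dmneg a)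
    (proj1 BF) (nmax _ BF) (Bdual _ BF).
  by move=> P [].
Qed.

Lemma card_le1P (T : Type) (A : set T) :
  (A #<= `I_1)%card <-> forall x y, A x -> A y -> x = y.
Proof.
split=> [/pcard_leP[f] x y Ax Ay|A1].
  apply: (@inj _ _ _ f); rewrite ?inE //.
  have := @funS _ _ _ _ f x Ax; have := @funS _ _ _ _ f y Ay.
  by rewrite /= !ltnS !leqn0 => /eqP -> /eqP ->.
have [[x Ax]|A0] := pselect (exists x, A x).
  have -> : A = [set x]%classic.
    by apply/seteqP; split=> y => [Ay|->//]; exact: A1.
  by rewrite (card_le_eql card_set1).
have -> : A = set0 by apply/seteqP; split=> x // Ax; case: A0; exists x.
exact: card_ge0.
Qed.

Section Identities.
Variables (d : Order.disp_t) (L : pkAlgType d).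

Lemma Cterm_identity1P :
  (forall x : L, dmneg (Cterm x) <= Cterm x) <-> forall P, ~ Body L P.
Proof.
split=> [C1 P BP|B0 x].
  (* [P] and its dual are both in the body, so the smaller one may be taken. *)
  wlog PdP : P BP / P `<=` dual_filter P.
    move=> wl; have [|dPP] := dual_filter_comparable (proj1 BP); first exact: wl.
    by have := wl _ (Body_dual BP); rewrite dual_filterK; apply.
  have [y Pny] := Body_dmneg_Cterm BP PdP.
  by have /PdP := prime_filterS (proj1 BP) (C1 y) Pny.
apply: le_prime_filters => P Pp.
have [/(spec_max_dense (x `&` dmneg x))//|Pm|/B0//] := prime_spec_cases Pp.
by move=> /(spec_min_Cterm Pm).
Qed.

(** By comparability it is enough to exclude that the dual of a body filter [F]
    is strictly larger than [F]. An [x] in [dual_filter F] but not in [F] would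
    put both [Cterm x] and its negation, hence every [Cterm y], in
    [dual_filter F], contradicting [Body_dmneg_Cterm]. *)
Lemma Cterm_identity2_self_dual (P : set L) :
  (forall x y : L, dmneg (Cterm x) `&` Cterm x <= Cterm y) ->
  Body L P -> dual_filter P = P.
Proof.
move=> C2.
suff sub F : Body L F -> F `<=` dual_filter F -> dual_filter F `<=` F.
  move=> BP; have [PdP|dPP] := dual_filter_comparable (proj1 BP).
    by apply/seteqP; split=> //; exact: sub.
  apply/seteqP; split=> //.
  by have := sub _ (Body_dual BP); rewrite dual_filterK; apply.
move=> BF FdF x dFx; apply: contrapT => nFx.
have Fp := proj1 BF; have dFp := dual_filter_prime Fp.
have [y Fny] := Body_dmneg_Cterm BF FdF.
have dFxx : dual_filter F (x `&` dmneg x).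
  by apply: (prime_filterI dFp) => //; rewrite /dual_filter /= dmnegK.
suff : dual_filter F (Cterm y) by [].
apply: (prime_filterS dFp (C2 x y)); apply: (prime_filterI dFp); last first.
  by apply/prime_filter_join => //; left.
rewrite /dual_filter /= dmnegK => /(prime_filter_join _ _ Fp)[].
  by move=> /(prime_filter_meet _ _ Fp)[].
by move=> /FdF; exact: prime_filter_pstar.
Qed.

(** A lone body filter equals its dual, so it cannot contain both [Cterm x] and
    [dmneg (Cterm x)]. *)
Lemma Cterm_identity2_Body (x y : L) :
  (forall P Q, Body L P -> Body L Q -> P = Q) ->
  dmneg (Cterm x) `&` Cterm x <= Cterm y.
Proof.
move=> B1; apply: le_prime_filters => P Pp.
move=> /(prime_filter_meet _ _ Pp)[PnC PC].
have [/(spec_max_dense (y `&` dmneg y))//|Pm|BP] := prime_spec_cases Pp.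
  by case: (spec_min_Cterm Pm PnC).
by move: PC; rewrite (B1 _ _ BP (Body_dual BP)).
Qed.

End Identities.

Theorem theorem3p3 (d : Order.disp_t) (L : pkAlgType d)
    (hL : subdirectly_irreducible L) :
  ((forall x : L, dmneg (Cterm x) <= Cterm x) <-> (Body L #= `I_0)%card)
  /\
  ((forall x y : L, dmneg (Cterm x) `&` Cterm x <= Cterm y) <->
     (Body L #<= `I_1)%card).
Proof.
split.
  rewrite Cterm_identity1P II0 card_eq0; split=> [B0|/eqP -> P []].
  by apply/eqP/seteqP; split=> // P /B0.
rewrite card_le1P; split=> [C2 P Q|B1 x y]; last exact: Cterm_identity2_Body.
by apply: self_dual_Body_unique => // F; exact: Cterm_identity2_self_dual.
Qed.
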